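(* For all $k \in \mathbb{N}$, we have $\mathcal{P}(\mathbf{J}, n^k) \subsetneq \mathcal{P}(\mathbf{J}, n^{k+1})$. More precisely, for all $k \in \mathbb{N}$ and all $d \in \mathbb{N}$ with $d \leq \lceil k/2 \rceil - 1$, we have $\mathcal{P}(\mathbf{J}_k, n^d) \subsetneq \mathcal{P}(\mathbf{J}_k, n^{d+1})$.
   Context: $\mathbb{N}$ includes $0$; $[n] = \{1, \ldots, n\}$; all alphabets are finite; $n^0 = 1$ for all $n$. Varieties. A variety of monoids is a class of finite monoids closed under submonoids, (finite) Cartesian products and morphic images. The idempotent power of a finite monoid $M$ is the smallest $\omega \in \mathbb{N}_{>0}$ with $x^\omega = x^{2\omega}$ for all $x \in M$. $\mathbf{J}$ is the variety of finite monoids $M$, of idempotent power $\omega$, such that $(xy)^\omega = (xy)^\omega x = y (xy)^\omega$ for all $x, y \in M$. A word $u = u_1 \cdots u_m$ is a subword of $w$ if it is a (not necessarily contiguous) subsequence of $w$. For an alphabet $\Sigma$ and $k \in \mathbb{N}$, $\sim_k$ is the congruence on $\Sigma^*$ defined by $u \sim_k v$ iff $u$ and $v$ have the same set of subwords of length at most $k$. $\mathbf{J}_k$ is the inclusion-wise smallest variety of monoids containing all quotients $\Sigma^* / {\sim_k}$ for all alphabets $\Sigma$. Programs. Let $M$ be a finite monoid, $\Sigma$ an alphabet and $n \in \mathbb{N}$. A program $P$ over $M$ on $\Sigma^n$ is a finite sequence of instructions $(i, f)$ with $i \in [n]$ and $f \colon \Sigma \to M$; its length $|P|$ is its number of instructions.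 On input $w \in \Sigma^n$, instruction $(i, f)$ outputs $f(w_i)$, and $P(w) \in M$ is the product, in order, of the outputs of the instructions. $P$ recognises $L \subseteq \Sigma^n$ if $L = P^{-1}(F)$ for some $F \subseteq M$. A language $L \subseteq \Sigma^*$ is recognised by a sequence $(P_n)_{n \in \mathbb{N}}$ of programs over one fixed finite monoid $M$ if for each $n$, $P_n$ is a program over $M$ on $\Sigma^n$ recognising $L \cap \Sigma^n$. For a variety of monoids $\mathbf{V}$ and $s \colon \mathbb{N} \to \mathbb{N}$, $\mathcal{P}(\mathbf{V}, s(n))$ is the class of languages (over arbitrary finite alphabets) recognised by some sequence $(P_n)_{n \in \mathbb{N}}$ of programs over some monoid in $\mathbf{V}$ for which there is a real $\alpha > 0$ with $|P_n| \leq \alpha \cdot s(n)$ for all $n \in \mathbb{N}$. *)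

(* Defs.v *)
From HB Require Import structures.
From mathcomp Require Import all_boot all_order all_algebra.
From mathcomp Require Import boolp classical_sets reals.

Set Implicit Arguments.
Unset Strict Implicit.
Unset Printing Implicit Defensive.

Local Open Scope classical_set_scope.
Local Open Scope quotient_scope.
Local Open Scope group_scope.

#[short(type="finMonoidType")]
HB.structure Definition FinMonoid := {M of monoid.Monoid M & Finite M}.

Definition dprod_monoid (I : finType) (M : I -> finMonoidType) :=
  {dffun forall i, M i}.

Section DProdMonoid.
Variables (I : finType) (M : I -> finMonoidType).

HB.instance Definition _ := Finite.on (dprod_monoid M).

Definition dprod_one : dprod_monoid M := [ffun i => 1 : M i].
Definition dprod_mul (f g : dprod_monoid M) : dprod_monoid M :=
  [ffun i => f i * g i].

Lemma dprod_mulA : associative dprod_mul.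
Proof. by move=> f g h; apply/ffunP => i; rewrite !ffunE mulgA. Qed.

Lemma dprod_mul1 : left_id dprod_one dprod_mul.
Proof. by move=> f; apply/ffunP => i; rewrite !ffunE mul1g. Qed.

Lemma dprod_mulr1 : right_id dprod_one dprod_mul.
Proof. by move=> f; apply/ffunP => i; rewrite !ffunE mulg1. Qed.

HB.instance Definition _ :=
  isMonoid.Build (dprod_monoid M) dprod_mulA dprod_mul1 dprod_mulr1.

End DProdMonoid.

Definition monoid_class := finMonoidType -> Prop.

(* Submonoids are presented by injective morphisms and morphic images by
   surjective ones, so that a variety is closed under isomorphism. *)
Definition is_variety (V : monoid_class) : Prop :=
  [/\ forall (M N : finMonoidType) (f : N -> M),
        monoid_morphism f -> injective f -> V M -> V N,
      forall (I : finType) (M : I -> finMonoidType),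
        (forall i, V (M i)) -> V (dprod_monoid M)
    & forall (M N : finMonoidType) (f : M -> N),
        monoid_morphism f -> (forall y, exists x, f x = y) ->
        V M -> V N].

Section IdempotentPower.
Variable M : finMonoidType.

Definition idempotent_exponent (w : nat) : bool :=
  (0 < w)%N && [forall x : M, x ^+ w == x ^+ (2 * w)].

Lemma idempotent_exponent1 (x : M) :
  exists n, (0 < n)%N && (x ^+ n == x ^+ (2 * n)).
Proof.
have /injectivePn[i [j]] : ~~ injectiveb (fun i : 'I_#|M|.+1 => x ^+ i).
  by apply/negP => /injectiveP/leq_card; rewrite card_ord ltnn.
wlog ltij : i j / (i < j)%N.
  move=> IH nij eij; case: (ltngtP i j) => [lt|lt|/val_inj e].
  - exact: (IH i j).
  - by apply: (IH j i) => //; rewrite eq_sym.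
  - by rewrite e eqxx in nij.
move=> _ eij; set p := (j - i)%N.
have p_gt0 : (0 < p)%N by rewrite subn_gt0.
have shift m q : (i <= m)%N -> x ^+ (m + q * p) = x ^+ m.
  move=> lem; elim: q => [|q IHq]; first by rewrite mul0n addn0.
  rewrite mulSnr addnA expgnDr IHq -expgnDr -{1}(subnK lem) -addnA.
  by rewrite /p subnKC ?(ltnW ltij)// expgnDr -eij -expgnDr subnK.
exists (i.+1 * p)%N; rewrite muln_gt0 p_gt0 mul2n -addnn shift ?eqxx //.
by apply: leq_trans (leqnSn i) _; rewrite leq_pmulr.
Qed.

Lemma idempotent_exponent_exists : exists w, idempotent_exponent w.
Proof.
pose e x := xchoose (idempotent_exponent1 x).
exists (\prod_(x : M) e x)%N; apply/andP; split.
  by rewrite prodn_gt0 // => x; case/andP: (xchooseP (idempotent_exponent1 x)).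
apply/forallP => x; rewrite (bigD1 x) //= mulnA (expgnA x (e x)) (expgnA x (2 * e x)).
by case/andP: (xchooseP (idempotent_exponent1 x)) => _ /eqP <-.
Qed.

Definition idempotent_power : nat := ex_minn idempotent_exponent_exists.

End IdempotentPower.

Definition varJ : monoid_class := fun M =>
  forall x y : M, let w := idempotent_power M in
    (x * y) ^+ w = (x * y) ^+ w * x /\ (x * y) ^+ w = y * (x * y) ^+ w.

Section SubwordCongruence.
Variables (Sigma : finType) (k : nat).
Implicit Types u v w : seq Sigma.

(* Boolean form, over the finitely many words of length at most k, of the
   relation spelled out in simkP. *)
Definition simk u v : bool :=
  [forall n : 'I_k.+1, forall t : n.-tuple Sigma, subseq t u == subseq t v].

Lemma simkP u v :
  reflect (forall t, (size t <= k)%N -> subseq t u = subseq t v) (simk u v).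
Proof.
apply: (iffP forallP) => [h t szt|h n].
  by have /forallP/(_ (in_tuple t))/eqP := h (Ordinal (szt : (size t < k.+1)%N)).
by apply/forallP => t; rewrite h // size_tuple -ltnS.
Qed.

Lemma simk_refl : reflexive simk.
Proof. by move=> u; apply/simkP. Qed.

Lemma simk_sym : symmetric simk.
Proof. by move=> u v; apply/simkP/simkP => h t szt; rewrite h. Qed.

Lemma simk_trans : transitive simk.
Proof. by move=> v u w /simkP h /simkP h' ; apply/simkP => t szt; rewrite h ?h'. Qed.

Canonical simk_equiv := EquivRel simk simk_refl simk_sym simk_trans.

Lemma subseq_catP t u v :
  reflect (exists i, subseq (take i t) u && subseq (drop i t) v)
          (subseq t (u ++ v)).
Proof.
apply: (iffP idP) => [/subseqP[m]|[i /andP[h1 h2]]]; last first.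
  by rewrite -(cat_take_drop i t) cat_subseq.
rewrite size_cat => szm ->.
have szm1 : size (take (size u) m) = size u.
  by rewrite size_take_min szm; apply/minn_idPl/leq_addr.
rewrite -(cat_take_drop (size u) m) mask_cat //.
exists (size (mask (take (size u) m) u)).
by rewrite take_size_cat // drop_size_cat // !mask_subseq.
Qed.

Lemma simk_cat u u' v v' : simk u u' -> simk v v' -> simk (u ++ v) (u' ++ v').
Proof.
move=> /simkP hu /simkP hv; apply/simkP => t szt.
apply/subseq_catP/subseq_catP => -[i h]; exists i; move: h.
  rewrite hu ?hv // ?size_drop ?(leq_trans (leq_subr _ _)) //.
  by rewrite size_take_min (leq_trans (geq_minr _ _)).
rewrite hu ?hv // ?size_drop ?(leq_trans (leq_subr _ _)) //.
by rewrite size_take_min (leq_trans (geq_minr _ _)).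
Qed.

Definition simk_quot := {eq_quot simk_equiv}.

HB.instance Definition _ := Choice.on simk_quot.
HB.instance Definition _ := EqQuotient.on simk_quot.

(* The quotient is finite: a class is determined by its set of subwords of
   length at most k. *)
Definition subwords_upto (q : simk_quot) :
    {dffun forall n : 'I_k.+1, {set n.-tuple Sigma}} :=
  [ffun n : 'I_k.+1 => [set t : n.-tuple Sigma | subseq t (repr q)]%SET].

Lemma subwords_upto_inj : injective subwords_upto.
Proof.
move=> p q /ffunP e; rewrite -[p]reprK -[q]reprK; apply/eqP.
rewrite piE; apply/forallP => n; apply/forallP => t.
by have /setP/(_ t) := e n; rewrite !ffunE !inE => ->.
Qed.

Definition subwords_upto_inv S : option simk_quot :=
  if pselect (exists q, subwords_upto q = S) is left ex
  then Some (projT1 (cid ex)) else None.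

Lemma subwords_uptoK : pcancel subwords_upto subwords_upto_inv.
Proof.
move=> q; rewrite /subwords_upto_inv; case: pselect => [ex|[]]; last by exists q.
by case: cid => p /= /subwords_upto_inj ->.
Qed.

HB.instance Definition _ := PCanIsCountable subwords_uptoK.
HB.instance Definition _ : isFinite simk_quot := PCanIsFinite subwords_uptoK.

Definition simk_one : simk_quot := lift_cst simk_quot [::].
Definition simk_mul : simk_quot -> simk_quot -> simk_quot :=
  lift_op2 simk_quot cat.

Canonical pi_simk_one := PiConst simk_one.

Lemma pi_simk_mul :
  {morph \pi_simk_quot : u v / (u ++ v)%SEQ >-> simk_mul u v}.
Proof.
move=> u v; unlock simk_mul; apply/eqP; rewrite piE; apply: simk_cat.
  by rewrite -[simk _ _]/(simk_equiv _ _) -eqmodE reprK.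
by rewrite -[simk _ _]/(simk_equiv _ _) -eqmodE reprK.
Qed.
Canonical pi_simk_mul_morph := PiMorph2 pi_simk_mul.

Lemma simk_mulA : associative simk_mul.
Proof.
by elim/quotW=> u; elim/quotW=> v; elim/quotW=> w; rewrite !piE catA.
Qed.

Lemma simk_mul1 : left_id simk_one simk_mul.
Proof. by elim/quotW=> u; rewrite !piE. Qed.

Lemma simk_mulr1 : right_id simk_one simk_mul.
Proof. by elim/quotW=> u; rewrite !piE cats0. Qed.

HB.instance Definition _ :=
  isMonoid.Build simk_quot simk_mulA simk_mul1 simk_mulr1.

End SubwordCongruence.

(* The smallest variety is the intersection of all varieties containing the
   quotients. *)
Definition varJk (k : nat) : monoid_class := fun M =>
  forall V : monoid_class, is_variety V ->
    (forall Sigma : finType, V (simk_quot Sigma k)) -> V M.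

(* The positions 1, ..., n are represented by 'I_n. *)
Definition program (M : finMonoidType) (Sigma : finType) (n : nat) :=
  seq ('I_n * (Sigma -> M)).

Definition program_eval (M : finMonoidType) (Sigma : finType) (n : nat)
    (P : program M Sigma n) (w : n.-tuple Sigma) : M :=
  \prod_(c <- P) c.2 (tnth w c.1).

Definition recognises (M : finMonoidType) (Sigma : finType) (n : nat)
    (P : program M Sigma n) (L : set (n.-tuple Sigma)) : Prop :=
  exists F : set M, L = program_eval P @^-1` F.

Definition language (Sigma : finType) := set (seq Sigma).

Definition slice (Sigma : finType) (L : language Sigma) (n : nat) :
    set (n.-tuple Sigma) := [set w | L (tval w)].
Arguments slice {Sigma} L n _.

Definition language_class := forall Sigma : finType, language Sigma -> Prop.

Definition prog_class (R : realType) (V : monoid_class) (s : nat -> nat) :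
    language_class := fun Sigma L =>
  exists (M : finMonoidType) (P : forall n, program M Sigma n),
    [/\ V M,
        forall n, recognises (P n) (slice L n)
      & exists2 alpha : R, (0 < alpha)%R &
          forall n, ((size (P n))%:R <= alpha * (s n)%:R)%R].

Definition language_subclass (C D : language_class) : Prop :=
  forall (Sigma : finType) (L : language Sigma), C Sigma L -> D Sigma L.

Definition proper_subclass (C D : language_class) : Prop :=
  language_subclass C D /\ ~ language_subclass D C.

(* Main.v *)
(* Upper bound: cut the input into d+1 blocks of p positions. For a set S of
   (d+1)-tuples, nested loops over the d outer blocks write an opening letter
   before and a closing letter after each iteration whose position holds a 1,
   and the innermost loop writes a letter for the tuples in S. Testing for the
   subword a_d .. a_1 a_0 c_1 .. c_d, of length 2d+1, is done by a
   program of length O(n^(d+1)) over the quotient by ~_(2d+1). On inputs with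
   exactly one 1 in each block it decides whether the positions of these 1s form
   a tuple of S, so that the 2^(p^(d+1)) sets S give distinct languages.
   Lower bound: there are only 2^(O(n^d log n)) programs of length O(n^d) over
   monoids of bounded size, so one can choose S for each n so as to defeat
   every monoid and every multiplicative constant. *)

Require Import Defs.
From mathcomp Require Import all_boot all_order all_algebra.
From mathcomp Require Import boolp classical_sets reals.
From mathcomp Require Import zify.

Set Implicit Arguments.
Unset Strict Implicit.
Unset Printing Implicit Defensive.

Import Order.TTheory GRing.Theory Num.Theory.

(** * The quotients by [simk] belong to J *)

Section SimkVarJ.
Local Open Scope group_scope.
Local Open Scope quotient_scope.
Variables (T : finType) (k : nat).
Implicit Types (s u v : seq T).

Lemma subseq_flatten_nseq n s v :
  (size s <= n)%N -> {subset s <= v} -> subseq s (flatten (nseq n v)).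
Proof.
elim: n s => [|n IHn] [|a s] //= szs sub; first by rewrite sub0seq.
rewrite -cat1s; apply: cat_subseq.
  by rewrite sub1seq sub ?mem_head.
by apply: IHn => // b bs; rewrite sub // inE bs orbT.
Qed.

Lemma mem_flatten_nseq n v : {subset flatten (nseq n v) <= v}.
Proof. by elim: n => //= n IHn a; rewrite mem_cat => /orP[|/IHn]. Qed.

(** Each copy of [v] can supply one chosen letter, so the [n] copies already contain every word of
    length at most [k] over the letters of [v]. *)
Lemma simk_saturated n v u1 u2 : (k <= n)%N -> {subset u1 <= v} -> {subset u2 <= v} ->
  simk k (u1 ++ flatten (nseq n v) ++ u2) (flatten (nseq n v)).
Proof.
move=> kn sub1 sub2; apply/simkP => t szt; apply/idP/idP => [tsub|].
  apply: subseq_flatten_nseq (leq_trans szt kn) _ => a.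
  move=> /(mem_subseq tsub); rewrite !mem_cat.
  by case/or3P => [/sub1|/mem_flatten_nseq|/sub2].
move=> /subseq_trans; apply.
by apply: subseq_trans (suffix_subseq _ _); apply: prefix_subseq.
Qed.

Lemma pi_simk_expg v n :
  (\pi_(simk_quot T k) v) ^+ n = \pi_(simk_quot T k) (flatten (nseq n v)).
Proof.
elim: n => [|n IHn]; first by rewrite -[LHS]/(simk_one T k) !piE.
by rewrite expgS IHn /= pi_simk_mul.
Qed.

Lemma expg_idempotent_power (M : finMonoidType) (x : M) (n : nat) :
  x ^+ idempotent_power M = x ^+ (idempotent_power M * n.+1).
Proof.
rewrite /idempotent_power; case: ex_minnP => w /andP[_ /forallP/(_ x)/eqP e] _.
elim: n => [|n IHn]; first by rewrite muln1.
by rewrite mulnS expgnDr -IHn -expgnDr addnn -mul2n.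
Qed.

Lemma idempotent_power_gt0 (M : finMonoidType) : (0 < idempotent_power M)%N.
Proof. by rewrite /idempotent_power; case: ex_minnP => w /andP[]. Qed.

Lemma simk_quot_varJ : varJ (simk_quot T k).
Proof.
move=> x y /=; set w := idempotent_power _.
(* The idempotent power may be smaller than [k]; a multiple of it gives enough copies for
   saturation. *)
rewrite (@expg_idempotent_power _ (x * y) k) -/w.
have kw : (k <= w * k.+1)%N.
  by apply: leq_trans (leq_pmull _ (idempotent_power_gt0 _)); exact: leqnSn.
elim/quotW: x => u; elim/quotW: y => v.
rewrite -[_ * _]/(simk_mul _ _) -pi_simk_mul pi_simk_expg.
have subu : {subset u <= u ++ v} by move=> a au; rewrite mem_cat au.
have subv : {subset v <= u ++ v} by move=> a av; rewrite mem_cat av orbT.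
have sub0 : {subset [::] <= u ++ v} by [].
split.
  rewrite -[RHS]/(simk_mul _ _) -pi_simk_mul; apply/eqP; rewrite eq_sym piE.
  exact: (simk_saturated kw sub0 subu).
rewrite -[RHS]/(simk_mul _ _) -pi_simk_mul; apply/eqP; rewrite eq_sym piE.
by have := simk_saturated kw subv sub0; rewrite cats0.
Qed.

End SimkVarJ.

(** * Nested loops and the languages they define *)

Section Nested.
Variables (d n : nat).
Let p := (n %/ d.+1)%N.
Let letter : finType := (bool * 'I_d.+1)%type.
Implicit Types (h : nat) (S : pred (seq 'I_p)).

Lemma block_position_lt h (i : 'I_p) : (h <= d)%N -> (h * p + i < n)%N.
Proof.
move=> hd; apply: (@leq_trans (h.+1 * p)).
  by rewrite mulSn addnC ltn_add2r.
by apply: leq_trans (leq_trunc_div n d.+1); rewrite mulnC leq_mul2l ltnS hd orbT.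
Qed.

(* The default of [insubd] is never reached when [h <= d] (see [val_position]). *)
Definition position h (i : 'I_p) : 'I_n :=
  insubd (widen_ord (leq_div n d.+1) i) (h * p + i)%N.

Lemma val_position h (i : 'I_p) : (h <= d)%N -> position h i = (h * p + i)%N :> nat.
Proof. by move=> hd; rewrite val_insubd block_position_lt. Qed.

Definition opening h : letter := (true, inord h).
Definition closing h : letter := (false, inord h).

Definition emit (a : letter) (b : bool) : seq letter := if b then [:: a] else [::].

(* Distinct letters for distinct levels force a pattern to stay within a single
   iteration of each loop. *)
Fixpoint nested h S : seq ('I_n * (bool -> seq letter)) :=
  if h is h'.+1 then
    flatten [seq (position h i, emit (opening h)) ::
                 rcons (nested h' (fun s => S (i :: s)))
                       (position h i, emit (closing h)) | i <- enum 'I_p]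
  else [seq (position 0 i, fun b => emit (opening 0) (b && S [:: i])) | i <- enum 'I_p].

Fixpoint pattern h : seq letter :=
  if h is h'.+1 then opening h :: rcons (pattern h') (closing h) else [:: opening 0].

Definition output (x : 'I_n -> bool) (P : seq ('I_n * (bool -> seq letter))) :=
  flatten [seq c.2 (x c.1) | c <- P].

Lemma size_pattern h : size (pattern h) = (2 * h).+1.
Proof. by elim: h => //= h IHh; rewrite size_rcons IHh; lia. Qed.

Lemma size_nested h S : (size (nested h S) <= (2 * h).+1 * p ^ h.+1)%N.
Proof.
elim: h S => [|h IHh] S /=; first by rewrite size_map size_enum_ord mul1n expn1.
rewrite size_flatten /shape -map_comp sumnE big_map.
apply: (@leq_trans (\sum_(i <- enum 'I_p) (2 + (2 * h).+1 * p ^ h.+1))%N).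
  by apply: leq_sum => i _ /=; rewrite size_rcons !addSn add0n !ltnS.
rewrite big_const_seq count_predT size_enum_ord iter_addn_0.
have -> : ((2 * h.+1).+1 * p ^ h.+2 = 2 * p ^ h.+2 + (2 * h).+1 * p ^ h.+2)%N by lia.
rewrite mulnDl -mulnA -expnSr leq_add2r leq_mul2l /=.
by case: (p) => // q; rewrite -{1}[q.+1]expn1 leq_pexp2l.
Qed.

Lemma output_cat x P Q : output x (P ++ Q) = output x P ++ output x Q.
Proof. by rewrite /output map_cat flatten_cat. Qed.

Lemma output_flatten x (I : Type) (F : I -> _) (r : seq I) :
  output x (flatten [seq F i | i <- r]) = flatten [seq output x (F i) | i <- r].
Proof. by elim: r => //= i r IHr; rewrite output_cat IHr. Qed.

Lemma output_block x h S i :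
  output x ((position h i, emit (opening h)) :: rcons (nested h.-1 S)
     (position h i, emit (closing h))) =
  emit (opening h) (x (position h i)) ++ output x (nested h.-1 S) ++
  emit (closing h) (x (position h i)).
Proof. by rewrite /output /= map_rcons flatten_rcons. Qed.

Lemma output_level x h S a : (h <= d)%N -> a \in output x (nested h S) -> (a.2 <= h)%N.
Proof.
have emitP b c : a \in emit b c -> a = b by case: c => //=; rewrite inE => /eqP.
elim: h S => [|h IHh] S hd /=.
  rewrite /output -map_comp => /flatten_mapP[i _ /emitP ->] /=.
  by rewrite inordK.
rewrite output_flatten => /flatten_mapP[i _].
rewrite (output_block x h.+1) !mem_cat.
by case/or3P => [/emitP->|/(IHh _ (ltnW hd))/leqW//|/emitP->]; rewrite /= inordK.
Qed.

Lemma subseq_cons_cat (T : eqType) (a : T) (s r1 r2 : seq T) : a \notin r1 ->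
  subseq (a :: s) (r1 ++ a :: r2) = subseq s r2.
Proof.
elim: r1 => [|b r1 IHr] /=; first by rewrite eqxx.
by rewrite inE negb_or => /andP[/negPf-> /IHr].
Qed.

Lemma subseq_rcons_cat (T : eqType) (a : T) (s r1 r2 : seq T) : a \notin r2 ->
  subseq (rcons s a) (r1 ++ a :: r2) = subseq s r1.
Proof.
move=> ar2; rewrite -subseq_rev rev_rcons rev_cat rev_cons cat_rcons.
by rewrite subseq_cons_cat ?mem_rev // subseq_rev.
Qed.

(** By induction on [h]: the brackets of the top level are written only in iteration [t h], so the
    inner pattern must match inside it. The outermost index is consed last, hence [rev]. *)
Lemma subseq_pattern_output (x : 'I_n -> bool) (t : nat -> 'I_p) h S :
  (forall h i, (h <= d)%N -> x (position h i) = (i == t h)) -> (h <= d)%N ->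
  subseq (pattern h) (output x (nested h S)) = S (rev (mkseq t h.+1)).
Proof.
move=> xt; elim: h S => [|h IHh] S hd.
  rewrite [pattern 0]/= sub1seq /=; apply/flattenP/idP => [[s]|St].
    rewrite -map_comp => /mapP[i _ ->] /=; rewrite xt //.
    by case: eqP => [->|] //=; case St : (S _).
  exists [:: opening 0]; last exact: mem_head.
  apply/mapP; exists (position 0 (t 0), fun b => emit (opening 0) (b && S [:: t 0])).
    by apply/mapP; exists (t 0); rewrite ?mem_enum.
  by rewrite /= xt // eqxx St.
have hd' := ltnW hd.
pose S' i s := S (i :: s).
pose B i := emit (opening h.+1) (x (position h.+1 i)) ++ output x (nested h (S' i)) ++
   emit (closing h.+1) (x (position h.+1 i)).
have -> : output x (nested h.+1 S) = flatten [seq B i | i <- enum 'I_p].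
  by rewrite /= output_flatten; congr flatten; apply: eq_map => i; exact: (output_block x h.+1).
have notin i b : (b, inord h.+1) \notin output x (nested h (S' i)).
  apply/negP => /(output_level hd') /=; rewrite inordK; lia.
have tin : t h.+1 \in enum 'I_p by rewrite mem_enum.
have: uniq (enum 'I_p) by exact: enum_uniq.
(* Isolate the only iteration that writes brackets of level [h.+1]. *)
case/splitPr: tin => r1 r2.
rewrite cat_uniq /= => /and3P[_ /norP[tr1 _] /andP[tr2 _]].
rewrite map_cat flatten_cat /= {2}/B xt // eqxx /= -!catA /=.
have notinB r b : t h.+1 \notin r -> (b, inord h.+1) \notin flatten [seq B i | i <- r].
  move=> tr; apply/flatten_mapP => -[i ir]; rewrite /B xt //.
  rewrite (negPf (_ : i != t h.+1)) ?cats0 ?(negPf (notin _ _)) //.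
  by apply: contraNneq tr => <-.
rewrite subseq_cons_cat ?notinB // subseq_rcons_cat ?notinB // IHh //.
by rewrite /S' /mkseq -[h.+2]addn1 iotaD map_cat rev_cat.
Qed.

Definition nested_language S (w : n.-tuple bool) : bool :=
  subseq (pattern d) (output (tnth w) (nested d S)).

Definition set_pred (A : {set d.+1.-tuple 'I_p}) : pred (seq 'I_p) :=
  fun s => [exists t in A, tval t == s].

Lemma set_predE A (t : d.+1.-tuple 'I_p) : set_pred A t = (t \in A).
Proof.
apply/existsP/idP => [[t' /andP[At' /eqP/val_inj <-]]//|At].
by exists t; rewrite At eqxx.
Qed.

Lemma nested_language_set_inj :
  injective (fun A : {set d.+1.-tuple 'I_p} =>
    [ffun w : n.-tuple bool => nested_language (set_pred A) w]).
Proof.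
move=> A B /ffunP eqAB; apply/setP => t.
(* Level 0 is the innermost loop and so reads the last component of [t]. The default only affects
   positions beyond the blocks, which no instruction reads. *)
pose u h := nth (thead t) (rev t) h.
pose w := [tuple (q %% p == u (q %/ p) :> nat)%N | q < n].
have xw h i : (h <= d)%N -> tnth w (position h i) = (i == u h).
  move=> hd; rewrite tnth_mktuple val_position //.
  have p_gt0 : (0 < p)%N by exact: leq_ltn_trans (ltn_ord i).
  by rewrite modnMDl divnMDl // modn_small // divn_small // addn0.
have eval A' : nested_language (set_pred A') w = (t \in A').
  rewrite /nested_language (subseq_pattern_output _ xw) // -set_predE; congr set_pred.
  by rewrite -[X in mkseq _ X](size_tuple t) -size_rev mkseq_nth revK.
by have := eqAB w; rewrite !ffunE !eval.
Qed.

End Nested.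

(** * Counting programs of bounded length over monoids of bounded size *)

Lemma card_set_of (T : finType) : #|{: {set T}}| = (2 ^ #|T|)%N.
Proof. by rewrite -(cardsT {set T}) -powersetT card_powerset cardsT. Qed.

Section Coding.
Local Open Scope group_scope.
Variables m l n : nat.

Definition code : finType :=
  ({ffun 'I_m.+1 * 'I_m.+1 -> 'I_m.+1} * 'I_m.+1 * {set 'I_m.+1} *
   l.-tuple (option ('I_n * {ffun bool -> 'I_m.+1})))%type.

(* [None] stands for the empty instruction, which pads programs to length [l]. *)
Definition code_step (op : {ffun 'I_m.+1 * 'I_m.+1 -> 'I_m.+1}) (w : n.-tuple bool)
    (o : option ('I_n * {ffun bool -> 'I_m.+1})) (z : 'I_m.+1) : 'I_m.+1 :=
  if o is Some c then op (c.2 (tnth w c.1), z) else z.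

Definition decode (c : code) : {ffun n.-tuple bool -> bool} :=
  let: (op, e, F, P) := c in
  [ffun w => foldr (code_step op w) e P \in F].

Lemma card_code :
  #|code| = (m.+1 ^ (m.+1 * m.+1) * m.+1 * 2 ^ m.+1 * (n * m.+1 ^ 2).+1 ^ l)%N.
Proof.
rewrite !card_prod card_ffun card_prod card_ord card_set_of card_ord card_tuple.
by rewrite card_option card_prod card_ffun card_bool !card_ord.
Qed.

Lemma program_decode (M : finMonoidType) (P : program M bool n) (F : set M) :
  (#|M| <= m.+1)%N -> (size P <= l)%N ->
  exists c : code, forall w, decode c w = `[< F (program_eval P w) >].
Proof.
move=> cardM szP.
(* [M] is transported into ['I_m.+1] along its enumeration; the bound on [#|M|] makes [psi] a left
   inverse. *)
pose phi (x : M) : 'I_m.+1 := inord (enum_rank x).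
pose psi (i : 'I_m.+1) : M := nth 1 (enum M) i.
have phiK : cancel phi psi.
  move=> x; rewrite /psi inordK ?nth_enum_rank //.
  exact: leq_trans (ltn_ord _) cardM.
pose op := [ffun xy : 'I_m.+1 * 'I_m.+1 => phi (psi xy.1 * psi xy.2)].
pose q := [seq Some (c.1, [ffun b => phi (c.2 b)]) | c <- P] ++ nseq (l - size P) None.
have szq : size q == l by rewrite size_cat size_map size_nseq subnKC.
exists (op, phi 1, [set i | `[< F (psi i) >]]%SET, Tuple szq) => w.
rewrite /= ffunE inE /= foldr_cat.
have -> : foldr (code_step op w) (phi 1) (nseq (l - size P) None) = phi 1.
  by elim: (l - size P)%N.
congr (`[< F _ >]); rewrite -[RHS]phiK; congr psi; rewrite /program_eval.
elim: (P) => [|c P' IHP] /=; first by rewrite big_nil.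
by rewrite big_cons IHP /op !ffunE /= !phiK.
Qed.

End Coding.

(** * Sets that defeat all short programs *)

Lemma exists_expn_ge c B K : exists2 q, (K <= q)%N & (c + (B + q) * K <= 2 ^ q)%N.
Proof.
(* With [q = r + r], the left side is at most [r + r * r], while [2 ^ q] is the square of
   [2 ^ r > r]. *)
pose r := (c + B * K + 2 * K)%N; exists (r + r)%N; first by rewrite /r; lia.
apply: (@leq_trans (r.+1 * r.+1)).
  by move: (erefl r); rewrite {1}/r; clearbody r; nia.
by rewrite expnD; apply: leq_mul; apply: ltn_expl.
Qed.

Lemma exists_code_lt c B K d : exists p : nat,
  [/\ (0 < p)%N, (K <= p)%N & (c * (B * p) ^ (K * p ^ d) < 2 ^ (p ^ d.+1))%N].
Proof.
have [q Kq p_ge] := exists_expn_ge c B K.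
have Bp : (B * 2 ^ q <= 2 ^ (B + q))%N.
  by rewrite expnD leq_mul2r; apply/orP; right; apply: ltnW; apply: ltn_expl.
have p_gt0 : (0 < 2 ^ q)%N by rewrite expn_gt0.
have Kp : (K <= 2 ^ q)%N by apply: leq_trans Kq _; apply: ltnW; apply: ltn_expl.
(* A power of two makes the logarithm of [p] equal to [q], so the exponents of 2 can be compared
   directly. *)
exists (2 ^ q)%N; split=> //.
move: (2 ^ q)%N Bp p_gt0 p_ge {Kp} => p Bp p_gt0 p_ge.
have pd_gt0 : (0 < p ^ d)%N by rewrite expn_gt0 p_gt0.
apply: (@leq_trans (2 ^ (c + (B + q) * (K * p ^ d)))%N); last first.
  rewrite leq_pexp2l // expnS; apply: leq_trans (leq_mul p_ge (leqnn _)).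
  by rewrite (mulnDl c) -mulnA leq_add2r leq_pmulr.
rewrite expnD (expnM 2).
apply: leq_ltn_trans (_ : c * (2 ^ (B + q)) ^ (K * p ^ d) < _)%N.
  rewrite leq_mul2l; apply/orP; right.
  by case: (K * p ^ d)%N => // e; rewrite leq_exp2r.
rewrite ltn_pmul2r; first exact: ltn_expl.
by rewrite !expn_gt0.
Qed.

(** A single [m] bounds both the monoid and the multiplicative constant, so countably many
    requirements cover all pairs. *)
Definition hard d n m (S : pred (seq 'I_(n %/ d.+1))) : Prop :=
  forall (M : finMonoidType) (P : program M bool n) (F : set M),
    (#|M| <= m)%N -> (size P <= m * n ^ d)%N ->
    exists w, nested_language S w <> `[< F (program_eval P w) >].

Lemma hardW d n m m' (S : pred (seq 'I_(n %/ d.+1))) :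
  (m <= m')%N -> hard m' S -> hard m S.
Proof.
move=> le hS M P F cM szP; apply: hS; first exact: leq_trans cM le.
by apply: leq_trans szP _; rewrite leq_mul2r le orbT.
Qed.

Lemma exists_hard d m :
  exists2 n, (m <= n)%N & exists S : pred (seq 'I_(n %/ d.+1)), hard m S.
Proof.
(* [c] counts tables, initial values and accepting sets. For [n = d.+1 * p] there are at most
   [B * p] choices per instruction, and the length bound is [K * p ^ d]. *)
pose c := (m.+1 ^ (m.+1 * m.+1) * m.+1 * 2 ^ m.+1)%N.
pose B := (d.+1 * m.+1 ^ 2).+1; pose K := (m * d.+1 ^ d)%N.
have [p [p_gt0 Kp lt2]] := exists_code_lt c B K d.
pose n := (d.+1 * p)%N; have np : (n %/ d.+1 = p)%N by rewrite mulKn.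
exists n.
  apply: (@leq_trans p); last exact: leq_pmull.
  by apply: leq_trans Kp; rewrite leq_pmulr ?expn_gt0.
pose f (A : {set d.+1.-tuple 'I_(n %/ d.+1)}) :=
  [ffun w : n.-tuple bool => nested_language (set_pred A) w].
have cardlt : (#|code m (m * n ^ d) n| < #|{set d.+1.-tuple 'I_(n %/ d.+1)}|)%N.
  rewrite card_set_of card_tuple card_ord np card_code.
  apply: leq_ltn_trans lt2; rewrite -/c leq_mul2l; apply/orP; right.
  have -> : (m * n ^ d = K * p ^ d)%N by rewrite /n expnMn mulnA.
  case: (K * p ^ d)%N => // e; rewrite leq_exp2r // /B mulSn /n mulnAC.
  by rewrite -add1n leq_add2r.
(* Otherwise choosing a code for each [A] would inject the sets into the fewer codes. *)
have [A noA] : exists A, forall c : code m (m * n ^ d) n, decode c <> f A.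
  apply: contrapT => /forallNP all_coded.
  have /choice[g fg] A : exists c : code m (m * n ^ d) n, decode c = f A.
    by apply: contrapT => /forallNP; exact: all_coded.
  have g_inj : injective g.
    by move=> A1 A2 e; apply: (@nested_language_set_inj d n); rewrite -/(f A1) -fg e fg.
  by have := leq_card g g_inj; rewrite leqNgt cardlt.
exists (set_pred A) => M P F cM szP.
have [q qE] := program_decode F (leqW cM) szP.
apply: contrapT => /forallNP all_eq; apply: (noA q); apply/ffunP => w.
rewrite qE ffunE; apply/esym/eqP; apply/negPn/negP => /eqP; exact: all_eq.
Qed.

(** One length may have to serve several bounds [m]. At length [n], take a set hard for the largest
    [m <= n] admitting one; by [hardW] it serves the smaller ones too. *)
Lemma exists_hard_family d : exists S : forall n, pred (seq 'I_(n %/ d.+1)),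
  forall m, exists n, hard m (S n).
Proof.
have best n N : exists S : pred (seq 'I_(n %/ d.+1)), forall m, (m < N)%N ->
    (exists S' : pred (seq 'I_(n %/ d.+1)), hard m S') -> hard m S.
  elim: N => [|N [S IHN]]; first by exists pred0.
  have [[S' hS']|noS'] := pselect (exists S' : pred (seq 'I_(n %/ d.+1)), hard N S').
    by exists S' => m; rewrite ltnS => mN _; apply: hardW hS'.
  exists S => m; rewrite ltnS leq_eqVlt => /orP[/eqP->|/IHN//].
  by move=> /noS'.
exists (fun n => projT1 (cid (best n n.+1))) => m.
have [n mn exS] := exists_hard d m; exists n.
by case: cid => /= S; apply.
Qed.

(** * Programs over [simk_quot] for the nested languages *)

Section NestedProgram.
Local Open Scope group_scope.
Local Open Scope quotient_scope.
Variables (d n k : nat) (S : pred (seq 'I_(n %/ d.+1))).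
Let letter : finType := (bool * 'I_d.+1)%type.

Definition nested_program : program (simk_quot letter k) bool n :=
  [seq (c.1, fun b => \pi_(simk_quot letter k) (c.2 b)) | c <- nested d S].

Lemma nested_program_eval w :
  program_eval nested_program w =
  \pi_(simk_quot letter k) (output (tnth w) (nested d S)).
Proof.
rewrite /program_eval /nested_program /output big_map.
elim: (nested d S) => [|c P IHP] /=; first by rewrite big_nil -[LHS]/(simk_one _ _) !piE.
by rewrite big_cons IHP pi_simk_mul.
Qed.

Lemma simk_repr_pi (u : seq letter) : simk k (repr (\pi_(simk_quot letter k) u)) u.
Proof.
by rewrite -[simk _ _ _]/(simk_equiv _ _ (repr _) u) -eqmodE reprK.
Qed.

(** The pattern has length [2 * d + 1], so its being a subword depends only on the class modulo
    [simk k]. *)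
Lemma nested_program_recognises : ((2 * d).+1 <= k)%N ->
  recognises nested_program [set w | nested_language S w]%classic.
Proof.
move=> dk; exists [set q | subseq (pattern d d) (repr q)]%classic.
apply/funext => w; rewrite /preimage /= nested_program_eval /nested_language.
by rewrite (simkP _ _ _ (simk_repr_pi _)) // size_pattern.
Qed.

Lemma size_nested_program : (size nested_program <= (2 * d).+1 * n ^ d.+1)%N.
Proof.
rewrite size_map; apply: leq_trans (size_nested d S) _.
by rewrite leq_mul2l leq_exp2r // leq_div orbT.
Qed.

End NestedProgram.

(** * Inclusion and strictness *)

Section Separation.
Variables (R : realType) (V : monoid_class).

Lemma prog_class_incl d :
  language_subclass (prog_class R V (fun n => n ^ d)%N)
                    (prog_class R V (fun n => n ^ d.+1)%N).
Proof.
move=> T L [M [P [VM recP [alpha alpha_gt0 szP]]]].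
exists M, P; split => //; exists alpha => // -[|n].
  (* At length 0 the new bound is 0; a program there is empty because ['I_0] has no element. *)
  case: (P 0%N) => [|[[]//]] /=.
  by rewrite mulr_ge0 // ltW.
apply: le_trans (szP _) _; rewrite ler_pM2l // ler_nat.
by rewrite leq_pexp2l.
Qed.

Lemma slice_family (T : finType) (f : forall n, n.-tuple T -> bool) n :
  slice [set s : seq T | f (size s) (in_tuple s)]%classic n = [set w | f n w]%classic.
Proof.
apply/funext => -[s szs]; rewrite /slice /=.
have e := eqP szs; subst n; congr (is_true (f _ _)); exact: val_inj.
Qed.

Lemma prog_class_proper d k : ((2 * d).+1 <= k)%N ->
  (forall T : finType, V (simk_quot T k)) ->
  proper_subclass (prog_class R V (fun n => n ^ d)%N)
                  (prog_class R V (fun n => n ^ d.+1)%N).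
Proof.
move=> dk Vk; split; first exact: prog_class_incl.
have [S hardS] := exists_hard_family d.
pose L : language bool :=
  [set s | nested_language (S (size s)) (in_tuple s)]%classic.
have sliceL n : slice L n = [set w | nested_language (S n) w]%classic.
  exact: (slice_family (fun n => @nested_language d n (S n))).
move=> /(_ bool L)[].
  exists (simk_quot (bool * 'I_d.+1)%type k), (fun n => nested_program k (S n)).
  split => // [n|]; first by rewrite sliceL; exact: nested_program_recognises.
  exists (2 * d).+1%:R%R => [|n]; first by rewrite ltr0n.
  by rewrite -natrM ler_nat size_nested_program.
move=> M [P [VM recP [alpha alpha_gt0 szP]]].
(* Hardness at this [m] covers both the size of [M] and the constant [alpha], so some [P n]
   fails. *)
pose m := maxn #|M| (Num.bound alpha).
have [n hard_n] := hardS m; have [F eqF] := recP n.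
have [||w neq] := hard_n M (P n) F; first exact: leq_maxl.
  rewrite -(ler_nat R); apply: le_trans (szP n) _; rewrite natrM ler_wpM2r //.
  apply: ltW; apply: lt_le_trans (archi_boundP (ltW alpha_gt0)) _.
  by rewrite ler_nat leq_maxr.
apply: neq; have := congr1 (fun A => A w) (etrans (esym (sliceL n)) eqF).
by rewrite /= /preimage /= => <-; rewrite asboolb.
Qed.

End Separation.

Theorem proposition3p3 (R : realType) :
  (forall k : nat,
     proper_subclass (prog_class R varJ (fun n => n ^ k)%N)
                     (prog_class R varJ (fun n => n ^ k.+1)%N)) /\
  (forall k d : nat, (d%:Z <= (uphalf k)%:Z - 1)%R ->
     proper_subclass (prog_class R (varJk k) (fun n => n ^ d)%N)
                     (prog_class R (varJk k) (fun n => n ^ d.+1)%N)).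
Proof.
split=> [k|k d dk].
  (* J contains the quotients at every level, in particular at level [2 * k + 1]. *)
  by apply: (@prog_class_proper R _ k _ (leqnn _)) => T; apply: simk_quot_varJ.
(* From [d + 1 <= uphalf k] follows [2 * d + 2 <= k + 1]. *)
apply: (@prog_class_proper R _ d k); first by lia.
by move=> T V _; apply.
Qed.
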